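(* Let $\mathbf f=\sum_{i=s}^{t}f_i(z)z^{i\delta}$ be a nonzero $\delta$-parametric polynomial with $f_s,f_t\ne0$ and let $\mathbf g$ be a nonzero $\delta$-parametric polynomial. Let $A$ be the maximum of $|j|$ over all $z^j$ occurring with nonzero coefficient in some $f_i$, and let $B\ge A$ be an integer such that $B\ge|j|$ for all $z^j$ occurring with nonzero coefficient in some coefficient polynomial of $\mathbf g$. Let $\Delta=[\deg_\delta(\mathbf g)-\mathrm{ord}_\delta(\mathbf g)]-[\deg_\delta(\mathbf f)-\mathrm{ord}_\delta(\mathbf f)]$ and $P=P_{f_t}$. Then: (a) if $\Delta<0$, there exists an integer $\delta\ge0$ with $\mathbf f_\delta\mid\mathbf g_\delta$ if and only if there exists such $\delta$ with $0\le\delta\le 2B+2A$; (b) if $\Delta\ge0$, there exists an integer $\delta\ge0$ with $\mathbf f_\delta\mid\mathbf g_\delta$ if and only if there exists such $\delta$ with $0\le\delta\le P^{\Delta}+2(B+4A\Delta)+4A+1$.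
   Context: $\mathbb{Z}_2$ is the two-element field. A $\delta$-parametric polynomial is a finite sum $\mathbf f=\sum_{i=s}^t f_i(z)z^{i\delta}$ with $f_i\in\mathbb{Z}_2[z^{\pm1}]$ (formally an element of $\mathbb{Z}_2[z^{\pm1},y^{\pm1}]$, $y$ standing for $z^\delta$); when nonzero with $f_s,f_t\ne0$, $\deg_\delta(\mathbf f)=t$ and $\mathrm{ord}_\delta(\mathbf f)=s$. $\mathbf f_\delta$ denotes the Laurent polynomial obtained by substituting the integer $\delta$. For Laurent polynomials, $g\mid h$ means $h=gq$ for some $q\in\mathbb{Z}_2[z^{\pm1}]$ (so $0$ divides only $0$). For a nonzero $h\in\mathbb{Z}_2[z^{\pm1}]$, put $H=h\,z^{-\mathrm{ord}(h)}\in\mathbb{Z}_2[z]$ (so $H(0)=1$), $n=\deg H$, let $V$ be the set of polynomials in $\mathbb{Z}_2[z]$ of degree less than $n$, and let $G$ be the permutation group on $V$ generated by the bijections $g\mapsto (gz)\bmod H$ and $g\mapsto(gz+1)\bmod H$ ($\bmod$ = remainder of division). Then $P_h:=|G|$. *)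

(* Defs.v *)
From mathcomp Require Import all_boot all_order all_algebra all_fingroup.
Set Implicit Arguments. Unset Strict Implicit. Unset Printing Implicit Defensive.
Import GRing.Theory.
Local Open Scope ring_scope.

(* A Laurent polynomial z^(-lsh) * lpol(z) in Z_2[z^{+-1}].  Equality of
   Laurent polynomials is coefficientwise (via [lcoef]), never Leibniz on
   this representation. *)
Record laurent := Laurent { lsh : nat ; lpol : {poly 'F_2} }.

Definition lzero : laurent := Laurent 0 0.

Definition lcoef (l : laurent) (j : int) : 'F_2 :=
  match (j + (lsh l)%:Z)%R with
  | Posz k => (lpol l)`_k
  | Negz _ => 0
  end.

Definition lnonzero (l : laurent) : Prop := exists j : int, lcoef l j != 0.

Definition lmul (a b : laurent) : laurent :=
  Laurent (lsh a + lsh b) (lpol a * lpol b).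

Definition ladd (a b : laurent) : laurent :=
  Laurent (lsh a + lsh b) ('X^(lsh b) * lpol a + 'X^(lsh a) * lpol b).

Definition lshift (e : int) (a : laurent) : laurent :=
  match e with
  | Posz k => Laurent (lsh a) ('X^k * lpol a)
  | Negz k => Laurent (lsh a + k.+1) (lpol a)
  end.

Definition ldvd (g h : laurent) : Prop :=
  exists q : laurent, forall j : int, lcoef (lmul g q) j = lcoef h j.

(* delta-parametric polynomial  sum_{k < size pcoefs} pcoefs_k z^((pord+k) delta) *)
Record ppoly := PPoly { pord : int ; pcoefs : seq laurent }.

Definition pcoef (f : ppoly) (k : nat) : laurent := nth lzero (pcoefs f) k.

Fixpoint pspec_aux (e step : int) (cs : seq laurent) : laurent :=
  match cs with
  | [::] => lzero
  | c :: cs' => ladd (lshift e c) (pspec_aux (e + step) step cs')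
  end.

Definition pspec (f : ppoly) (delta : int) : laurent :=
  pspec_aux (pord f * delta) delta (pcoefs f).

(* H = h z^(-ord h) : strip the power of z from the underlying polynomial *)
Definition Hpoly (h : laurent) : {poly 'F_2} :=
  let p := lpol h in Poly (drop (find (fun c => c != 0) p) p).

Section Ph.
Variables (n : nat) (H : {poly 'F_2}).
(* V = polynomials of degree < n, encoded by their coefficient vectors *)
Definition Vtype := {ffun 'I_n -> 'F_2}.
Definition vpoly (v : Vtype) : {poly 'F_2} := \sum_(i < n) (v i)%:P * 'X^i.
Definition polyv (p : {poly 'F_2}) : Vtype := [ffun i : 'I_n => p`_i].
Definition mapz (v : Vtype) : Vtype := polyv ((vpoly v * 'X) %% H).
Definition mapz1 (v : Vtype) : Vtype := polyv ((vpoly v * 'X + 1) %% H).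
Definition toperm (f : Vtype -> Vtype) : {perm Vtype} :=
  odflt 1%g [pick s : {perm Vtype} | [forall x, s x == f x]].
Definition permgroup : {set {perm Vtype}} :=
  <<[set toperm mapz; toperm mapz1]>>%g.
End Ph.

Definition Pval (h : laurent) : nat :=
  let H := Hpoly h in #|permgroup (size H).-1 H|.

(* Main.v *)
(** Write a parametric polynomial as a polynomial in y over F_2[z], with
    y = z^delta.  At large delta the degree and the order of f_delta can be read
    off from the outer coefficients, so a remainder of smaller y-degree is
    divisible by f_delta only if it vanishes formally; this is part (a).  For (b),
    pseudo-divide: f_t^(Delta+1) g = Q f + R.  At large delta the divisibility
    forces R = 0, and is then equivalent to f_t^(Delta+1) | Q(z, z^delta), hence,
    up to a power of z, to H^(Delta+1) | Q(z, z^delta).  This last condition is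
    periodic in delta, and P^Delta is a period: if e is the order of g |-> gz
    mod H, then H | z^e - 1, and 2e | P because the orbit of 0 is all of V while
    its stabilizer contains g |-> gz.  In characteristic 2 this gives
    H^(2^Delta) | (z^e - 1)^(2^Delta) = z^(2^Delta e) - 1, and 2^Delta >= Delta + 1.
    For Delta = 0 the quotient Q does not involve y, so every period works. *)

Require Import Defs.
From mathcomp Require Import all_boot all_order all_algebra all_fingroup.
From mathcomp Require Import zify ring.
Set Implicit Arguments. Unset Strict Implicit. Unset Printing Implicit Defensive.
Import GRing.Theory.
Local Open Scope ring_scope.

(** * The group generated by the two shift maps modulo [H] *)

Section ShiftRegisterGroup.

Variables (n : nat) (H : {poly 'F_2}).
Hypotheses (size_H : size H = n.+1) (H0 : H`_0 != 0).

Let H_neq0 : H != 0. Proof. by rewrite -size_poly_eq0 size_H. Qed.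

Lemma vpolyE (v : Vtype n) : vpoly v = \poly_(i < n) (if insub i is Some j then v j else 0).
Proof.
rewrite poly_def /vpoly; apply: eq_bigr => i _.
by rewrite valK mul_polyC.
Qed.

Lemma coef_vpoly (v : Vtype n) (i : 'I_n) : (vpoly v)`_i = v i.
Proof. by rewrite vpolyE coef_poly ltn_ord valK. Qed.

Lemma size_vpoly (v : Vtype n) : (size (vpoly v) <= n)%N.
Proof. by rewrite vpolyE size_poly. Qed.

Lemma vpolyK : cancel (@vpoly n) (polyv n).
Proof. by move=> v; apply/ffunP => i; rewrite ffunE coef_vpoly. Qed.

Lemma polyvK (p : {poly 'F_2}) : (size p <= n)%N -> vpoly (polyv n p) = p.
Proof.
move=> sp; apply/polyP => i; rewrite vpolyE coef_poly.
case: ltnP => [lin|lni]; first by rewrite insubT ffunE.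
by rewrite nth_default // (leq_trans sp).
Qed.

Lemma size_modH (p : {poly 'F_2}) : (size (p %% H)%R <= n)%N.
Proof. by rewrite -ltnS -size_H ltn_modp. Qed.

Lemma coprimepXn_of_coef0 (k : nat) : coprimep H 'X^k.
Proof.
by apply: coprimep_expr; rewrite coprimepX /root horner_coef0.
Qed.

(** Since [H] has nonzero constant term, ['X] is invertible modulo [H]. Injectivity is what keeps
    [toperm] from falling back on its default, the identity. *)
Lemma shift_inj (c : {poly 'F_2}) :
  injective (fun v : Vtype n => polyv n ((vpoly v * 'X + c) %% H)).
Proof.
move=> v w /(congr1 (@vpoly n)); rewrite !polyvK ?size_modH // => /eqP.
rewrite -subr_eq0 -modpN -modpD.
rewrite (_ : _ - _ = (vpoly v - vpoly w) * 'X); last by ring.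
rewrite -/(dvdp _ _) => Hd.
have {Hd} : H %| vpoly v - vpoly w.
  by rewrite -(Gauss_dvdpl _ (coprimepXn_of_coef0 1)) expr1.
rewrite /dvdp modp_small ?subr_eq0 => [/eqP/(can_inj vpolyK)//|].
rewrite size_H ltnS (leq_trans (size_polyD _ _)) //.
by rewrite size_polyN geq_max !size_vpoly.
Qed.

Lemma topermE (k : Vtype n -> Vtype n) : injective k -> toperm k =1 k.
Proof.
move=> inj_k x; rewrite /toperm; case: pickP => [s /forallP/(_ x)/eqP //|].
move/(_ (perm inj_k)) => /negbT/negP[]; apply/forallP => y.
by rewrite permE.
Qed.

Lemma topermzE : toperm (@mapz n H) =1 @mapz n H.
Proof.
apply: topermE => v w; rewrite /mapz => eq_vw.
by apply: (@shift_inj 0); rewrite !addr0.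
Qed.

Lemma topermz1E : toperm (@mapz1 n H) =1 @mapz1 n H.
Proof. exact/topermE/shift_inj. Qed.

Let T := toperm (@mapz n H).
Let T1 := toperm (@mapz1 n H).
Let G := permgroup n H.

Lemma vpoly_mapz_iter (k : nat) (v : Vtype n) :
  vpoly ((T ^+ k)%g v) = (vpoly v * 'X^k) %% H.
Proof.
elim: k => [|k IH].
  by rewrite expg0 perm1 expr0 mulr1 modp_small // size_H ltnS size_vpoly.
rewrite expgSr permM [T _]topermzE /mapz polyvK ?size_modH // IH.
by rewrite mulrC modp_mul exprS mulrCA.
Qed.

(** The trivial power [T ^+ #[T]] fixes the vector of the constant 1, which is its own remainder
    because [0 < n]. *)
Lemma dvdp_Xn_sub1_order : (0 < n)%N -> H %| 'X^#[T]%g - 1.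
Proof.
move=> n_gt0; have s1 : (size (1%R : {poly 'F_2}) <= n)%N by rewrite size_poly1.
have := vpoly_mapz_iter #[T]%g (polyv n 1%R).
rewrite expg_order perm1 polyvK // mul1r => e1.
rewrite /dvdp modpD modpN -e1 [1 %% H]modp_small ?subrr //.
by rewrite size_H ltnS.
Qed.

(* A polynomial of degree below [n] is reached from [0] by feeding its
   coefficients in Horner order, and no reduction modulo [H] ever occurs. *)
Lemma polyv_in_orbit (p : {poly 'F_2}) :
  (size p <= n)%N -> polyv n p \in orbit 'P <<[set T; T1]>>%g (polyv n 0%R).
Proof.
elim/poly_ind: p => [_|p c IH sp]; first exact: orbit_refl.
have sp' : (size p <= n)%N.
  apply: leq_trans sp; rewrite size_MXaddC; case: ifP => // /andP[/eqP-> _].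
  by rewrite size_poly0.
have modH : (p * 'X + c%:P) %% H = p * 'X + c%:P.
  by rewrite modp_small // size_H ltnS.
have c01 : (c == 0) || (c == 1) by case: c {sp modH} => -[|[|]].
have [t Gt tp] : exists2 t, t \in <<[set T; T1]>>%g & t (polyv n p) = polyv n (p * 'X + c%:P).
  case/orP: c01 modH => /eqP-> modH.
    exists T; first by apply: mem_gen; rewrite !inE eqxx.
    by rewrite [T _]topermzE /mapz polyvK // -modH polyC0 addr0.
  exists T1; first by apply: mem_gen; rewrite !inE eqxx orbT.
  by rewrite [T1 _]topermz1E /mapz1 polyvK // polyC1 modH.
rewrite -tp; apply: orbit_trans (IH sp'); exact: mem_orbit.
Qed.

Lemma double_order_dvd_permgroup : (0 < n)%N -> (2 * #[T]%g %| #|G|)%N.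
Proof.
move=> n_gt0; rewrite -[#|G|](card_orbit_stab 'P _ (polyv n 0%R)).
(* The factor 2 comes from the orbit, of size [2 ^ n] with [0 < n]; the factor [#[T]] comes from the
   stabilizer. *)
apply: dvdn_mul.
  have -> : orbit 'P <<[set T; T1]>>%g (polyv n 0%R) = [set: Vtype n].
    apply/setP => v; rewrite inE -[v]vpolyK.
    exact: polyv_in_orbit (size_vpoly v).
  by rewrite cardsT card_ffun card_Fp // card_ord dvdn_exp.
rewrite cardSg // cycle_subG inE; apply/andP; split.
  by apply: mem_gen; rewrite !inE eqxx.
apply/astab1P; rewrite /= /aperm [T _]topermzE /mapz polyvK ?size_poly0 //.
by rewrite mul0r mod0p.
Qed.

End ShiftRegisterGroup.

(** * Periodicity of powers of z modulo a power of [H] *)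

Lemma dvdp_Xn_sub1 (a b : nat) :
  (a %| b)%N -> ('X^a - 1 : {poly 'F_2}) %| 'X^b - 1.
Proof.
case/dvdnP => c ->; rewrite mulnC exprM.
by rewrite (subrX1 ('X^a)) dvdp_mulr.
Qed.

Lemma Xn_sub1_exp2 (e k : nat) :
  ('X^e - 1) ^+ (2 ^ k) = 'X^(2 ^ k * e) - 1 :> {poly 'F_2}.
Proof.
have ch : 2%N \in [pchar {poly 'F_2}] by rewrite pchar_poly pchar_Fp.
rewrite mulnC exprM.
elim: k => [|k IH]; first by rewrite !expr1.
rewrite expnSr !exprM IH -!(pFrobenius_autE ch).
by rewrite pFrobenius_autB_comm ?pFrobenius_aut1 //; apply: mulrC.
Qed.

Lemma dvdp_exp_Xn_sub1_permgroup (h : laurent) (D j : nat) :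
  let H := Hpoly h in (0 < D)%N -> H`_0 != 0 ->
  H ^+ D.+1 %| 'X^(Pval h ^ D * j) - 1.
Proof.
move=> H D_gt0 H0; rewrite /Pval -/H.
have H_neq0 : H != 0 by apply: contraNneq H0 => ->; rewrite coef0.
have size_H : size H = (size H).-1.+1 by rewrite prednK // size_poly_gt0.
have [n0|n_gt0] := posnP (size H).-1.
  have /size_poly1P[c c0 Hc] : size H == 1 by rewrite size_H n0.
  rewrite (@dvdp_trans _ 1) ?dvd1p // Hc dvdp1 -polyC_exp size_polyC.
  by rewrite expf_neq0.
pose e := #[toperm (@mapz (size H).-1 H)]%g.
have He : H ^+ (2 ^ D) %| 'X^(2 ^ D * e) - 1.
  by rewrite -Xn_sub1_exp2 dvdp_exp2r // dvdp_Xn_sub1_order.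
have HD : H ^+ D.+1 %| H ^+ (2 ^ D) by rewrite dvdp_exp2l // ltn_expl.
apply: dvdp_trans HD (dvdp_trans He _); apply: dvdp_Xn_sub1.
(* [2 ^ D * e] divides [(2 * e) ^ D] because [0 < D]. *)
apply: dvdn_mulr; apply: (@dvdn_trans ((2 * e) ^ D)).
  by rewrite expnMn dvdn_mul // dvdn_exp.
by rewrite dvdn_exp2r // double_order_dvd_permgroup.
Qed.

(** * Bivariate polynomials evaluated at y = z^d *)

Section ParametricEvaluation.

Variable K : fieldType.
Implicit Types (p q H : {poly K}) (F G Q R : {poly {poly K}}).

Lemma strip_Xn p : p != 0 ->
  let v := find (fun c => c != 0) p in
  [/\ (v < size p)%N, p = 'X^v * Poly (drop v p) & (Poly (drop v p))`_0 != 0].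
Proof.
move=> p0 v; have hp : has (fun c => c != 0) p.
  apply/hasP; exists (lead_coef p); rewrite ?lead_coef_eq0 //.
  by rewrite mem_nth // prednK // size_poly_gt0.
split; first by rewrite -has_find.
  apply/polyP => i; rewrite coefXnM coef_Poly nth_drop.
  case: ltnP => [iv|vi]; last by rewrite subnKC.
  by have /negbFE/eqP := before_find 0 iv.
by rewrite coef_Poly nth_drop addn0; apply: (nth_find 0 hp).
Qed.

Lemma dvdp_mulXn (k : nat) p q : p`_0 != 0 -> (p %| 'X^k * q) = (p %| q).
Proof.
move=> p0; rewrite Gauss_dvdpr //.
by apply: coprimep_expr; rewrite coprimepX /root horner_coef0.
Qed.

Definition coef_size_le (a : nat) F := forall i, (size (F`_i)%R <= a.+1)%N.

Lemma size_sum_mulXn_le (a d m : nat) (c : nat -> {poly K}) :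
  (forall i, size (c i) <= a.+1)%N ->
  (size (\sum_(i < m.+1) c i * 'X^d ^+ i)%R <= m * d + a.+1)%N.
Proof.
move=> hc; apply: leq_trans (size_sum _ _ _) _; apply/bigmax_leqP => i _.
rewrite -exprM; apply: leq_trans (size_polyMleq _ _) _; rewrite size_polyXn.
have := hc i; have : (d * i <= m * d)%N by rewrite mulnC leq_mul2r -ltnS ltn_ord orbT.
by lia.
Qed.

Lemma size_eval_Xn_le (a d : nat) F : coef_size_le a F ->
  (size (F.['X^d])%R <= (size F).-1 * d + a.+1)%N.
Proof.
move=> hF; rewrite horner_coef; case: (size F) => [|m].
  by rewrite big_ord0 size_poly0.
exact: size_sum_mulXn_le.
Qed.

(** With m the y-degree, the top term has z-degree at least m d, the others at most (m - 1) d + a <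
    m d, so nothing cancels it. *)
Lemma size_eval_Xn_ge (a d : nat) F : coef_size_le a F -> (a < d)%N -> F != 0 ->
  ((size F).-1 * d < size (F.['X^d])%R)%N.
Proof.
move=> hF ad F0; rewrite horner_coef.
have L0 : F`_(size F).-1 != 0 by rewrite -lead_coefE lead_coef_eq0.
have : (0 < size F)%N by rewrite size_poly_gt0.
case: (size F) L0 => // m; rewrite /= => L0 _; rewrite big_ord_recr /= addrC -exprM.
have sL : (m * d < size (F`_m * 'X^(d * m))%R)%N.
  rewrite size_Mmonic ?monicXn // size_polyXn addnS /= mulnC.
  by rewrite -addn1 addnC leq_add2r size_poly_gt0.
rewrite size_polyDl //; apply: leq_ltn_trans sL.
case: m {L0} => [|m]; first by rewrite big_ord0 size_poly0.
by apply: leq_trans (size_sum_mulXn_le _ _ hF) _; lia.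
Qed.

Lemma eval_Xn_neq0 (a d : nat) F :
  coef_size_le a F -> (a < d)%N -> F != 0 -> F.['X^d] != 0.
Proof.
by move=> hF ad F0; rewrite -size_poly_gt0 (leq_ltn_trans _ (size_eval_Xn_ge hF ad F0)).
Qed.

(** All terms but [F]_0[are divisible by z^d, and]F[_0] has order at most a < d; it alone fixes the
    order in z. *)
Lemma strip_eval_Xn (a d : nat) F : coef_size_le a F -> (a < d)%N -> F`_0 != 0 ->
  exists v p, [/\ (v <= a)%N, F.['X^d] = 'X^v * p & p`_0 != 0].
Proof.
move=> hF ad F00; have [] := strip_Xn F00.
set v := find _ _; set p := Poly _ => vs F0E p0.
have va : (v <= a)%N by rewrite -ltnS (leq_trans vs).
exists v, ((Poly (behead F)).['X^d] * 'X^(d - v) + p); split=> //.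
  rewrite {1}(_ : F = Poly (behead F) * 'X + (F`_0)%:P); last first.
    apply/polyP => -[|i]; rewrite coefD coefMX coefC coef_Poly nth_behead /=.
      by rewrite add0r.
    by rewrite addr0.
  rewrite hornerMXaddC {1}F0E mulrDr mulrCA -exprD subnKC //.
  by rewrite ltnW // (leq_ltn_trans va).
rewrite coefD coefMXn subn_gt0 (leq_ltn_trans va) // add0r.
exact: p0.
Qed.

(** With m the y-degree of [F], stripping z from [F.['X^d]] leaves a [p] of degree at least m d - a,
    coprime to z. It divides [R.['X^d]], whose degree is at most (m - 1) d + c, which is too small
    once d > a + c unless [R = 0]. *)
Lemma eval_dvd_eq0 (a c d k : nat) F R :
    coef_size_le a F -> coef_size_le c R -> F`_0 != 0 ->
    (size R < size F)%N -> (a + c < d)%N ->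
  F.['X^d] %| 'X^k * R.['X^d] -> R = 0.
Proof.
move=> hF hR F00 RF acd FR; apply/eqP/negPn/negP => R0.
have F0 : F != 0 by apply: contraNneq F00 => ->; rewrite coef0.
have ad : (a < d)%N by lia.
have Rd0 : R.['X^d] != 0 by apply: eval_Xn_neq0 hR _ R0; lia.
have [v [p [va Fd p0]]] := strip_eval_Xn hF ad F00.
have pR : p %| R.['X^d].
  by rewrite -(dvdp_mulXn k _ p0) (dvdp_trans _ FR) // Fd dvdp_mull.
have := dvdp_leq Rd0 pR.
have := size_eval_Xn_ge hF ad F0; have := size_eval_Xn_le d hR.
have p_neq0 : p != 0 by apply: contraNneq p0 => ->; rewrite coef0.
rewrite Fd mulrC size_Mmonic ?monicXn // size_polyXn [(_ + v.+1)%N]addnS /=.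
have: (0 < size R)%N by rewrite size_poly_gt0.
case: (size F) RF => // m; case: (size R) => // r.
rewrite ltnS /= => rm _; have : (r * d + d <= m * d)%N by rewrite -mulSnr leq_mul2r rm orbT.
by move: (size _) (size p); lia.
Qed.

(** Each of the [k] steps multiplies by the leading coefficient and raises the z-degree bound by
    [a]. The bound on [size Q] makes [Q] free of y when [k = 1]. *)
Lemma pseudo_division (a b m k : nat) F G :
    coef_size_le a F -> coef_size_le b G -> size F = m.+1 -> (size G <= m + k)%N ->
  exists Q R, [/\ lead_coef F ^+ k *: G = Q * F + R, (size R <= m)%N,
                  coef_size_le (b + k * a) R & (size Q <= k)%N].
Proof.
move=> hF + sF; elim: k b G => [|k IH] b G hG sG.
  exists 0, G; rewrite expr0 scale1r mul0r add0r size_poly0 mul0n addn0.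
  by split=> //; move: sG; rewrite addn0.
(* [c] may be 0; the step is carried out all the same, so that the power of the leading coefficient
   is exactly [k]. *)
pose c := G`_(m + k).
pose G' := lead_coef F *: G - c%:P * 'X^k * F.
have sizeM p q i j : (size p <= i.+1 -> size q <= j.+1 -> size (p * q)%R <= (i + j).+1)%N.
  by move=> sp sq; apply: leq_trans (size_polyMleq _ _) _; lia.
have coefG' i : G'`_i = lead_coef F * G`_i - c * (if (i < k)%N then 0 else F`_(i - k)).
  by rewrite coefB coefZ -mulrA coefCM coefXnM.
have hG' : coef_size_le (b + a) G'.
  move=> i; rewrite coefG'; apply: leq_trans (size_polyD _ _) _.
  rewrite size_polyN geq_max {1}(addnC b) !sizeM ?lead_coefE //.
    exact: hG.
  by case: ifP => _; [rewrite size_poly0 | apply: hF].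
have sG' : (size G' <= m + k)%N.
  apply/leq_sizeP => i mki; rewrite coefG' ltnNge (leq_trans (leq_addl m k)) //=.
  have [mk_lt|mk_ge|<-] := ltngtP (m + k)%N i; last 1 first.
  - by rewrite -/c addnK lead_coefE sF mulrC subrr.
  - rewrite (nth_default _ (leq_trans sG _)) ?addnS // mulr0 sub0r.
    by rewrite nth_default ?mulr0 ?oppr0 // sF; lia.
  - by lia.
have [Q [R [E sR hR sQ]]] := IH _ _ hG' sG'.
exists ((lead_coef F ^+ k * c)%:P * 'X^k + Q), R; split=> //.
- rewrite mulrDl -addrA -E /G' scalerBr scalerA -exprSr -!mul_polyC polyCM.
  by rewrite !mulrA addrC subrK.
- by rewrite mulSn addnA.
- apply: leq_trans (size_polyD _ _) _; rewrite geq_max (leq_trans sQ) // andbT.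
  by rewrite mul_polyC (leq_trans (size_scale_leq _ _)) // size_polyXn.
Qed.

Lemma eval_sub_dvd Q p q : p - q %| Q.[p] - Q.[q].
Proof.
rewrite !horner_coef -sumrB; apply: (big_ind (fun x => p - q %| x)) => [|x y|i _].
- exact: dvdp0.
- exact: dvdp_add.
- by rewrite -mulrBr subrXX dvdp_mull // dvdp_mulr.
Qed.

(** [D] bounds the excess of the y-degree of [G] over that of [F]. The exponents [u] and [w] say
    that the leading coefficient is [H] up to a power of z, a unit among Laurent polynomials. *)
Lemma eval_dvd_periodic (a b m D N d u w k : nat) F G H :
    coef_size_le a F -> coef_size_le b G -> F`_0 != 0 ->
    size F = m.+1 -> (size G <= m + D.+1)%N ->
    'X^u * lead_coef F = 'X^w * H -> H`_0 != 0 ->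
    ((0 < D)%N -> forall j, H ^+ D.+1 %| 'X^(N * j) - 1) ->
    (a + (b + D.+1 * a) < d)%N ->
    F.['X^d] %| 'X^k * G.['X^d] ->
  exists k', F.['X^(d %% N)] %| 'X^k' * G.['X^(d %% N)].
Proof.
move=> hF hG F00 sF sG LH H0 HN dbig FG.
have F0 : F != 0 by rewrite -size_poly_gt0 sF.
have L0 : lead_coef F != 0 by rewrite lead_coef_eq0.
have [Q [R [E sR hR sQ]]] := pseudo_division hF hG sF sG.
set L := lead_coef F in LH L0 E.
have Ev x : L ^+ D.+1 * G.[x] = Q.[x] * F.[x] + R.[x].
  by have := congr1 (fun P => P.[x]) E; rewrite !hornerE.
(* [R] vanishes formally, so the identity proved from the large [d] holds at every [x], in
   particular at the reduced exponent. *)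
have {}E x : L ^+ D.+1 * G.[x] = Q.[x] * F.[x].
  rewrite Ev; suff -> : R = 0 by rewrite horner0 addr0.
  apply: (eval_dvd_eq0 (k := k) hF hR F00 _ dbig); first by rewrite sF ltnS.
  rewrite (_ : R.[_] = L ^+ D.+1 * G.['X^d] - Q.['X^d] * F.['X^d]); last first.
    by rewrite Ev addrAC subrr add0r.
  rewrite mulrBr dvdp_sub //; first by rewrite mulrCA dvdp_mull.
  by rewrite mulrA dvdp_mull.
have Fd0 : F.['X^d] != 0 by apply: eval_Xn_neq0 hF _ F0; lia.
have LQ : L ^+ D.+1 %| 'X^k * Q.['X^d].
  rewrite -(dvdp_mul2r _ _ Fd0) -mulrA -E mulrCA dvdp_mul2l //.
  by rewrite expf_neq0.
have HQ : H ^+ D.+1 %| Q.['X^d].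
  rewrite -(dvdp_mulXn k) -?horner_coef0 ?horner_exp ?expf_neq0 ?horner_coef0 //.
  have HL : H ^+ D.+1 %| ('X^u * L) ^+ D.+1 by rewrite LH dvdp_exp2r // dvdp_mull.
  rewrite -(dvdp_mulXn (u * D.+1)) -?horner_coef0 ?horner_exp ?expf_neq0 ?horner_coef0 //.
  by rewrite (dvdp_trans HL) // exprMn -exprM dvdp_mul.
have HQ' : H ^+ D.+1 %| Q.['X^(d %% N)].
  have -> : Q.['X^(d %% N)] = Q.['X^d] - (Q.['X^d] - Q.['X^(d %% N)]) by ring.
  apply: dvdp_sub => //; have [D0|D_gt0] := posnP D.
    have -> : Q = (Q`_0)%:P by apply: size1_polyC; rewrite -D0 in sQ *.
    by rewrite !hornerC subrr dvdp0.
  apply: dvdp_trans (eval_sub_dvd _ _ _).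
  (* The difference of the two points is z^(d mod N) (z^(N (d / N)) - 1). *)
  rewrite {1}(divn_eq d N) exprD -[X in _ - X]mul1r -mulrBl mulnC.
  by rewrite dvdp_mulr // HN.
have : L ^+ D.+1 %| 'X^(w * D.+1) * Q.['X^(d %% N)].
  have LH' : L ^+ D.+1 %| ('X^w * H) ^+ D.+1 by rewrite -LH dvdp_exp2r // dvdp_mull.
  by rewrite (dvdp_trans LH') // exprMn -exprM dvdp_mul.
move=> LQ'; exists (w * D.+1)%N.
have LD0 : L ^+ D.+1 != 0 by rewrite expf_neq0.
(* Only the power of [L] is cancelled: at the small exponent [F.['X^(d %% N)]] may be 0. *)
rewrite -(dvdp_mul2l _ _ LD0) mulrCA E mulrA.
exact: dvdp_mul.
Qed.

End ParametricEvaluation.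

(** * Laurent polynomials inside the field of rational functions *)

Local Notation "x %:F" := (@FracField.tofrac {poly 'F_2} x).
Local Notation zF := (('X : {poly 'F_2})%:F).

(** In the fraction field, coefficientwise equality becomes Leibniz equality and z has negative
    powers. *)
Definition lfrac (l : laurent) : {fraction {poly 'F_2}} := (lpol l)%:F / zF ^+ lsh l.

Lemma zF_neq0 : zF != 0. Proof. by rewrite tofrac_eq0 polyX_eq0. Qed.

Lemma coef_XnM_lpol (l : laurent) (t i : nat) :
  ('X^t * lpol l)`_i = lcoef l (i%:Z - (lsh l)%:Z - t%:Z).
Proof.
rewrite coefXnM /lcoef (_ : _ + _ = i%:Z - t%:Z); last by ring.
case: ltnP => [it|ti]; last by rewrite subzn.
by case E : (i%:Z - t%:Z) => //; lia.
Qed.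

Lemma lfrac_eq (l l' : laurent) : (forall j, lcoef l j = lcoef l' j) <-> lfrac l = lfrac l'.
Proof.
have XE (t : nat) : zF ^+ t = ('X^t)%:F by rewrite tofracXn.
have -> : (lfrac l = lfrac l') <-> ('X^(lsh l') * lpol l = 'X^(lsh l) * lpol l').
  rewrite /lfrac; split=> [/eqP|E].
    rewrite eqr_div ?expf_neq0 ?zF_neq0 // !XE -!tofracM tofrac_eq => /eqP E.
    by rewrite mulrC E mulrC.
  apply/eqP; rewrite eqr_div ?expf_neq0 ?zF_neq0 // !XE -!tofracM tofrac_eq.
  by rewrite mulrC E mulrC.
split=> [E|/polyP E j].
  apply/polyP => i; rewrite !coef_XnM_lpol E; congr lcoef; ring.
case Ej : (j + (lsh l)%:Z + (lsh l')%:Z) => [i|i].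
  have := E i; rewrite !coef_XnM_lpol.
  by congr (lcoef _ _ = lcoef _ _); lia.
(* The remaining [j] lie below the range of both representations. *)
have neg (s : nat) (p : {poly 'F_2}) : j + s%:Z < 0 -> lcoef (Laurent s p) j = 0.
  by rewrite /lcoef /=; case: (j + s%:Z).
by case: l l' Ej {E} => s p [s' p'] /= Ej; rewrite !neg //; lia.
Qed.

Lemma lfracM (a b : laurent) : lfrac (lmul a b) = lfrac a * lfrac b.
Proof. by rewrite /lfrac /= tofracM exprD invfM mulrACA. Qed.

Lemma lfracD (a b : laurent) : lfrac (ladd a b) = lfrac a + lfrac b.
Proof.
rewrite /lfrac /= tofracD !tofracM !tofracXn addf_div ?expf_neq0 ?zF_neq0 //.
by rewrite exprD [in LHS]mulrC [_ * (lpol b)%:F]mulrC mulrC; congr ((_ + _) / _); rewrite mulrC.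
Qed.

Lemma lfrac_shift (e : int) (a : laurent) : lfrac (Defs.lshift e a) = zF ^ e * lfrac a.
Proof.
case: e => k /=; rewrite /lfrac /=; first by rewrite tofracM tofracXn -mulrA.
by rewrite -[zF ^ _]/(zF ^- k.+1) exprD invfM mulrA mulrC.
Qed.

Lemma lfrac0 : lfrac lzero = 0.
Proof. by rewrite /lfrac /= tofrac0 mul0r. Qed.

Lemma lfrac_spec_aux (e step : int) (cs : seq laurent) :
  lfrac (pspec_aux e step cs) =
  \sum_(i < size cs) zF ^ (e + i%:Z * step) * lfrac (nth lzero cs i).
Proof.
elim: cs e => [|c cs IH] e /=; first by rewrite big_ord0 lfrac0.
rewrite big_ord_recl lfracD lfrac_shift IH /= mul0r addr0; congr (_ + _).
apply: eq_bigr => i _; congr (zF ^ _ * _).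
by rewrite /bump /= intS; ring.
Qed.

(** * From parametric polynomials to bivariate ones *)

(** This is z^a l when all exponents of [l] lie in [-a, a]. The shift does not depend on [lsh l], so
    one [a] serves all coefficients of a parametric polynomial. *)
Definition lpoly (a : nat) (l : laurent) : {poly 'F_2} :=
  \poly_(i < a.*2.+1) lcoef l (i%:Z - a%:Z).

Lemma XnM_lpoly (a : nat) (l : laurent) :
  (forall j, lcoef l j != 0 -> (`|j| <= a)%N) ->
  'X^(lsh l) * lpoly a l = 'X^a * lpol l.
Proof.
move=> hl; apply/polyP => i; rewrite coef_XnM_lpol coefXnM coef_poly.
have l0 j : (a < `|j|)%N -> lcoef l j = 0.
  by move=> aj; apply: contraTeq aj => /hl; rewrite -leqNgt.
case: ltnP => [il|li]; first by rewrite l0 //; lia.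
case: ltnP => [ia|ai]; last by rewrite l0 //; lia.
by congr lcoef; lia.
Qed.

Lemma lfrac_lpoly (a : nat) (l : laurent) :
  (forall j, lcoef l j != 0 -> (`|j| <= a)%N) ->
  lfrac l = zF ^ (- a%:Z) * (lpoly a l)%:F.
Proof.
move=> /XnM_lpoly E; rewrite -exprnN mulrC /lfrac; apply/eqP.
rewrite eqr_div ?expf_neq0 ?zF_neq0 // -!tofracXn -!tofracM tofrac_eq.
by rewrite mulrC -E mulrC.
Qed.

Lemma lpoly_neq0 (a : nat) (l : laurent) :
  (forall j, lcoef l j != 0 -> (`|j| <= a)%N) -> lnonzero l -> lpoly a l != 0.
Proof.
move=> hl [j lj]; have ja := hl _ lj; apply: contraNneq lj => E.
have := congr1 (fun p : {poly 'F_2} => p`_(absz (j + a%:Z))) E.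
rewrite coef0 coef_poly ifT; last by lia.
by move=> <-; apply/eqP; congr lcoef; lia.
Qed.

(** [pord f] is dropped: at each d it contributes only a power of z. *)
Definition bipoly (a : nat) (f : ppoly) : {poly {poly 'F_2}} :=
  \poly_(k < size (pcoefs f)) lpoly a (pcoef f k).

Section Bipoly.

Variables (a : nat) (f : ppoly).
Hypothesis ha : forall (i : nat) (j : int), (i < size (pcoefs f))%N ->
  lcoef (pcoef f i) j != 0 -> (`|j| <= a)%N.

Lemma coef_size_bipoly : coef_size_le a.*2 (bipoly a f).
Proof.
by move=> i; rewrite coef_poly; case: ifP => _; rewrite ?size_poly0 // size_poly.
Qed.

Lemma lfrac_spec (d : nat) :
  lfrac (pspec f d) = zF ^ (pord f * d%:Z - a%:Z) * ((bipoly a f).['X^d])%:F.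
Proof.
rewrite /pspec lfrac_spec_aux horner_poly rmorph_sum mulr_sumr.
apply: eq_bigr => i _; rewrite (lfrac_lpoly (fun j => ha (j := j) (ltn_ord i))) /=.
rewrite tofracM -exprM tofracXn exprnP mulrA [in RHS]mulrCA -!expfzDr ?zF_neq0 //.
by rewrite mulrC; congr (_ * zF ^ _); rewrite PoszM; ring.
Qed.

Hypotheses (f0 : (0 < size (pcoefs f))%N)
           (ft : lnonzero (pcoef f (size (pcoefs f)).-1)).

Lemma size_bipoly : size (bipoly a f) = size (pcoefs f).
Proof.
apply: size_poly_eq; apply: lpoly_neq0 => // j; apply: ha.
by rewrite prednK.
Qed.

Lemma lead_coef_bipoly :
  lead_coef (bipoly a f) = lpoly a (pcoef f (size (pcoefs f)).-1).
Proof. by rewrite lead_coefE size_bipoly coef_poly prednK // leqnn. Qed.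

End Bipoly.

(** Powers of z are units among Laurent polynomials; the factor ['X^k] clears the negative exponents
    of the quotient. *)
Lemma ldvdP (l l' : laurent) (e e' : int) (p p' : {poly 'F_2}) :
  lfrac l = zF ^ e * p%:F -> lfrac l' = zF ^ e' * p'%:F ->
  ldvd l l' <-> exists k : nat, p %| 'X^k * p'.
Proof.
move=> El El'; split=> [[q /lfrac_eq]|[k /dvdpP[q Eq]]].
  rewrite lfracM El El' /lfrac => E.
  have [t [t' tt']] : exists t t' : nat, e - (lsh q)%:Z - e' = t%:Z - t'%:Z.
    case: (e - (lsh q)%:Z - e') => n; first by exists n, 0%N; rewrite subr0.
    by exists 0%N, n.+1; rewrite NegzE sub0r.
  exists t'; apply/dvdpP; exists ('X^t * lpol q).
  apply/eqP; rewrite -tofrac_eq !tofracM !tofracXn; apply/eqP.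
  have := congr1 ( *%R (zF ^ (t'%:Z - e'))) E.
  rewrite [in RHS]mulrA -expfzDr ?zF_neq0 // subrK => <-.
  rewrite !exprnP invr_expz.
  rewrite (_ : _ * _ = zF ^ (t'%:Z - e') * zF ^ e * zF ^ (- (lsh q)%:Z)
                       * (p%:F * (lpol q)%:F)); last by ring.
  rewrite -!expfzDr ?zF_neq0 // (_ : _ + _ = t%:Z); last by lia.
  by rewrite -mulrA [(lpol q)%:F * _]mulrC.
exists (Defs.lshift (e' - e - k%:Z) (Laurent 0 q)); apply/lfrac_eq.
rewrite lfracM El El' lfrac_shift /lfrac /= expr0 divr1 mulrACA.
rewrite -expfzDr ?zF_neq0 // -tofracM mulrC [p * q]mulrC -Eq tofracM tofracXn exprnP.
by rewrite mulrAC -expfzDr ?zF_neq0 //; congr (zF ^ _ * _); ring.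
Qed.

Lemma lnonzero_lpol_neq0 (l : laurent) : lnonzero l -> lpol l != 0.
Proof.
case=> j; apply: contraNneq; rewrite /lcoef => ->.
by case: (j + _) => // k; rewrite coef0.
Qed.

(** * The bounds on delta *)

Theorem mainTheorem17 (f g : ppoly) (A B : nat)
  (hf0 : (0 < size (pcoefs f))%N)
  (hfs : lnonzero (pcoef f 0))
  (hft : lnonzero (pcoef f (size (pcoefs f)).-1))
  (hg0 : (0 < size (pcoefs g))%N)
  (hgs : lnonzero (pcoef g 0))
  (hgt : lnonzero (pcoef g (size (pcoefs g)).-1))
  (hA : forall (i : nat) (j : int), (i < size (pcoefs f))%N ->
          lcoef (pcoef f i) j != 0 -> (`|j| <= A)%N)
  (hAmax : exists (i : nat) (j : int), [/\ (i < size (pcoefs f))%N,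
          lcoef (pcoef f i) j != 0 & `|j|%N = A])
  (hAB : (A <= B)%N)
  (hB : forall (i : nat) (j : int), (i < size (pcoefs g))%N ->
          lcoef (pcoef g i) j != 0 -> (`|j| <= B)%N) :
  let Delta : int := (size (pcoefs g))%:Z - (size (pcoefs f))%:Z in
  let P : nat := Pval (pcoef f (size (pcoefs f)).-1) in
  (Delta < 0 ->
     ((exists d : nat, ldvd (pspec f d) (pspec g d)) <->
     (exists d : nat, (d <= 2 * B + 2 * A)%N /\ ldvd (pspec f d) (pspec g d)))) /\
  (0 <= Delta ->
     ((exists d : nat, ldvd (pspec f d) (pspec g d)) <->
     (exists d : nat,
        (d <= P ^ `|Delta| + 2 * (B + 4 * A * `|Delta|) + 4 * A + 1)%N
        /\ ldvd (pspec f d) (pspec g d)))).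
Proof.
move=> Delta P; set F := bipoly A f; set G := bipoly B g.
have dvdE (d : nat) :
    ldvd (pspec f d) (pspec g d) <-> exists k : nat, F.['X^d] %| 'X^k * G.['X^d].
  exact: ldvdP (lfrac_spec hA d) (lfrac_spec hB d).
have sF : size F = size (pcoefs f) := size_bipoly hA hf0 hft.
have sG : size G = size (pcoefs g) := size_bipoly hB hg0 hgt.
have cF : coef_size_le A.*2 F := coef_size_bipoly A f.
have cG : coef_size_le B.*2 G := coef_size_bipoly B g.
have F00 : F`_0 != 0 by rewrite coef_poly hf0 lpoly_neq0 // => j; apply: hA.
split=> sgn; split=> [[d /[dup] fg /dvdE[k FG]]|[d [_ fg]]]; try by exists d.
  exists d; split=> //; rewrite leqNgt; apply/negP => dbig.
  (* [G] is its own remainder. After the shifts by [A] and [B] the z-degrees are at most 2A and 2B,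
     whence the threshold 2A + 2B. *)
  have G0 : G = 0.
    by apply: (eval_dvd_eq0 (d := d) (k := k) cF cG F00) => //; rewrite ?sF ?sG; lia.
  by move: hg0; rewrite -sG G0 size_poly0.
set bound := (_ + 1)%N; have [db|bd] := leqP d bound; first by exists d.
have [D DE] : exists D : nat, Delta = D by exists (absz Delta); lia.
have sFm : size F = (size (pcoefs f)).-1.+1 by rewrite sF prednK.
pose h := pcoef f (size (pcoefs f)).-1.
have h0 : lpol h != 0 by apply: lnonzero_lpol_neq0.
have [_ hE H0] := strip_Xn h0; set v := find _ _ in hE.
(* [lead_coef F] is z^A h as a Laurent polynomial, and [lpol h] is z^v times [Hpoly h]. *)
have LH : 'X^(lsh h) * lead_coef F = 'X^(A + v) * Hpoly h.
  rewrite (lead_coef_bipoly hA hf0 hft) XnM_lpoly; last by move=> j; apply: hA; rewrite prednK.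
  by rewrite exprD -mulrA -hE.
have P_gt0 : (0 < P ^ D)%N by rewrite expn_gt0 cardG_gt0.
exists (d %% (P ^ D))%N; split.
  by rewrite /bound DE /=; have := ltn_pmod d P_gt0; lia.
apply/dvdE.
apply: (eval_dvd_periodic (D := D) cF cG F00 sFm _ LH H0 _ _ FG).
- by rewrite sG; lia.
- by move=> D_gt0 j; apply: dvdp_exp_Xn_sub1_permgroup.
(* The threshold is 2A + (2B + (D + 1) 2A) = 2B + 2AD + 4A, which lies below [bound]. *)
- by move: bd; rewrite /bound DE /=; nia.
Qed.
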